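(* Let $(G,E,\nu)$ be a weighted graph with controlled weights which satisfies the elliptic Harnack inequality (EHI) with a constant $C_1$. Then there exist constants $C$, $\theta$, depending only on $C_1$, such that $$|B(x_0,R)| \le C\, R^{1+\theta},\qquad x_0\in G,\ R\ge 1 .$$
   Context: A weighted graph $(G,E,\nu)$ consists of a locally finite connected graph $\Gamma=(G,E)$ with vertex set $G$ and edge set $E$ (write $x\sim y$ if $\{x,y\}\in E$) together with a conductance matrix $\nu=(\nu_{xy})_{x,y\in G}$ satisfying $\nu_{xy}\ge 0$, $\nu_{xy}=\nu_{yx}$, and $\nu_{xy}>0$ if and only if $x\sim y$. Put $\mu(x)=\sum_y\nu_{xy}$. Let $d$ be the graph distance, $B(x,r)=\{y\in G: d(x,y)\le r\}$, and let $|A|$ denote the number of elements of a set $A$. The Laplacian is $\Delta f(x)=\frac{1}{\mu(x)}\sum_y\nu_{xy}(f(y)-f(x))$. For $A\subset G$, let $\partial A=\{y\in A^c: d(x,y)=1 \text{ for some } x\in A\}$ and $\overline A=A\cup\partial A$. A function $h$ is harmonic on $A$ if it is defined (at least) on $\overline A$, is real valued, and $\Delta h(x)=0$ for all $x\in A$. Controlled weights: there exists $p_0>0$ such that $\nu_{xy}/\mu(x)\ge p_0$ for all $x\in G$ and all $y\sim x$. (EHI) with constant $C_1>0$: for any $x\in G$, $R\ge 1$, and non-negative $h:G\to\mathbb R$ harmonic in $B(x,2R)$, one has $\sup_{B(x,R)}h\le C_1\inf_{B(x,R)}h$.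
   Formalization: θ depends only on C_1, but C may also depend on the controlled-weights constant p_0; C depending on C_1 alone is false: complete graphs K_N with unit weights satisfy (EHI) with C_1 = 1, yet |B(x,1)| = N. *)

(* Defs.v *)
From mathcomp Require Import all_boot all_order all_algebra.
From mathcomp Require Import all_classical all_reals all_analysis.

Set Implicit Arguments.
Unset Strict Implicit.
Unset Printing Implicit Defensive.

Import Order.TTheory GRing.Theory Num.Theory.

Local Open Scope classical_set_scope.
Local Open Scope ring_scope.

(* The carrier is only a [choiceType] so that finitely supported sums and
   cardinals of sets make sense; it may be infinite. *)
Record weighted_graph (R : realType) (G : choiceType) := WeightedGraph {
  adj : rel G;
  conductance : G -> G -> R;
  adj_irreflexive : irreflexive adj;
  adj_symmetric : symmetric adj;
  adj_locally_finite : forall x, finite_set [set y | adj x y];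
  adj_connected : forall x y, exists2 p : seq G, path adj x p & last x p = y;
  conductance_ge0 : forall x y, 0 <= conductance x y;
  conductance_sym : forall x y, conductance x y = conductance y x;
  conductance_gt0 : forall x y, 0 < conductance x y <-> adj x y
}.

Section WeightedGraphTheory.
Context {R : realType} {G : choiceType} (W : weighted_graph R G).
Implicit Types (x y : G) (A : set G) (h : G -> R).

Definition walk x y (n : nat) : Prop :=
  exists p : seq G, [/\ path (adj W) x p, last x p = y & size p = n].

Lemma walk_exists x y : exists n, `[< walk x y n >].
Proof.
have [p xp py] := adj_connected W x y.
by exists (size p); apply/asboolP; exists p.
Qed.

Definition gdist x y : nat := ex_minn (walk_exists x y).

Definition gball x (r : R) : set G := [set y | (gdist x y)%:R <= r].

(* The supports of the two sums below are finite by local finiteness, so the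
   convention that [\sum_(y \in A)] is 0 on an infinite support never
   applies. *)
Definition vweight x : R := \sum_(y \in [set: G]) conductance W x y.

Definition laplacian h x : R :=
  (vweight x)^-1 * \sum_(y \in [set: G]) conductance W x y * (h y - h x).

(* [laplacian h x] with [x] in [A] only involves the values of [h] on [A] and
   its outer boundary, so the values of the total function [h] elsewhere are
   irrelevant. *)
Definition harmonic_on A h : Prop := forall x, A x -> laplacian h x = 0.

Definition controlled_weights (p0 : R) : Prop :=
  forall x y, adj W x y -> p0 <= conductance W x y / vweight x.

Definition EHI (C1 : R) : Prop :=
  forall x (r : R) h, 1 <= r ->
    (forall y, 0 <= h y) -> harmonic_on (gball x (2 * r)) h ->
    sup (h @` gball x r) <= C1 * inf (h @` gball x r).

End WeightedGraphTheory.

(* Main.v *)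
Require Import Defs.
From mathcomp Require Import all_boot all_order all_algebra.
From mathcomp Require Import all_classical all_reals all_analysis.
From mathcomp Require Import finmap zify ring lra.

Set Implicit Arguments.
Unset Strict Implicit.
Unset Printing Implicit Defensive.

Import Order.TTheory GRing.Theory Num.Theory numFieldNormedType.Exports.

(** For y on the sphere of radius n about x0, let h_y be the harmonic measure of
    y for the open ball of radius n.  Starting next to y, where h_y >= p0, and
    moving along a geodesic to x0, one can double the distance to y at the cost
    of one application of (EHI); hence h_y(x0) >= p0^2 C1^(-m) as soon as
    n <= 2^m.  Since the h_y(x0) add up to at most 1, the sphere has at most
    p0^(-2) C1^m points, that is O(n^(log_2 C1)), and summing over the spheres
    gives the volume bound. *)

Local Open Scope ring_scope.

(** * Walks, graph distance and finiteness of balls *)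

Section GraphDistance.
Local Open Scope nat_scope.
Local Open Scope classical_set_scope.
Context {R : realType} {G : choiceType} (W : weighted_graph R G).
Implicit Types x y z : G.

Lemma walk_cat {x y z m n} : walk W x y m -> walk W y z n -> walk W x z (m + n).
Proof.
move=> [p [xp py <-]] [q [yq qz <-]]; exists (p ++ q).
by rewrite cat_path xp last_cat py yq size_cat.
Qed.

Lemma walk_split {x z} m {n} :
  walk W x z (m + n) -> exists2 y, walk W x y m & walk W y z n.
Proof.
move=> [p [xp pz sp]]; move: xp pz; rewrite -{1 2}(cat_take_drop m p).
rewrite cat_path last_cat => /andP[xp yp] pz.
exists (last x (take m p)).
  by exists (take m p); rewrite size_takel// sp leq_addr.
by exists (drop m p); rewrite size_drop sp addKn.
Qed.

Lemma walk1 x y : walk W x y 1 -> adj W x y.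
Proof. by move=> [[|z [|? ?]] [//= /andP[xz _] <-]]. Qed.

Lemma walk0 x y : walk W x y 0 -> x = y.
Proof. by move=> [[|? ?] []]. Qed.

Lemma gdist_walk x y : walk W x y (gdist W x y).
Proof. by rewrite /gdist; case: ex_minnP => n /asboolP. Qed.

Lemma gdist_le_walk x y n : walk W x y n -> gdist W x y <= n.
Proof. by rewrite /gdist; case: ex_minnP => m _ + xy; apply; exact/asboolP. Qed.

Lemma gdistxx x : gdist W x x = 0.
Proof. by apply/eqP; rewrite -leqn0; apply: gdist_le_walk; exists [::]. Qed.

Lemma gdist_triangle y x z : gdist W x z <= gdist W x y + gdist W y z.
Proof. exact/gdist_le_walk/walk_cat/gdist_walk/gdist_walk. Qed.

(** By local finiteness, each walk length reaches only finitely many endpoints. *)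
Lemma finite_gball x (r : R) : finite_set (gball W x r).
Proof.
have finw n : finite_set [set y | walk W x y n].
  elim: n => [|n ih].
    by apply: (@sub_finite_set _ _ [set x]) => // y /walk0 ->.
  apply: (sub_finite_set _ (bigcup_finite ih (fun z _ => adj_locally_finite W z))).
  by move=> y /=; rewrite -addn1 => /walk_split[z xz /walk1 zy]; exists z.
apply: (sub_finite_set _ (bigcup_finite
  (finite_II (Num.truncn r).+1) (fun n _ => finw n))).
move=> y /= xy; exists (gdist W x y); last exact: gdist_walk.
by rewrite /= ltnS truncn_ge_nat// (le_trans _ xy).
Qed.

End GraphDistance.

(** * Random walk averages and harmonic measure *)

Section HarmonicMeasure.
Local Open Scope classical_set_scope.
Context {R : realType} {G : choiceType} (W : weighted_graph R G).
Implicit Types (x y : G) (f h : G -> R).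

Definition neighbours x : seq G := fset_set [set y | adj W x y].

(** The transition operator of the random walk: a function is harmonic where [average] fixes it. *)
Definition average f x : R :=
  (vweight W x)^-1 * \sum_(y <- neighbours x) conductance W x y * f y.

Lemma conductance_eq0 x y : y \notin neighbours x -> conductance W x y = 0.
Proof.
rewrite in_fset_set ?notin_setE; last exact: adj_locally_finite.
move=> /= /negP xy; apply/eqP; apply: contraNT xy => c0.
by apply/conductance_gt0; rewrite lt0r c0 conductance_ge0.
Qed.

Lemma sum_conductance x f :
  \sum_(y \in [set: G]) conductance W x y * f y =
  \sum_(y <- neighbours x) conductance W x y * f y.
Proof.
rewrite (fsbigE (neighbours x)) ?fset_uniq//; first by apply: eq_bigl => y; rewrite in_setT.
by move=> y _ /conductance_eq0 ->; rewrite mul0r.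
Qed.

Lemma vweightE x : vweight W x = \sum_(y <- neighbours x) conductance W x y.
Proof.
rewrite /vweight; under eq_fsbigr do rewrite -[conductance _ _ _]mulr1.
by rewrite sum_conductance; under eq_bigr do rewrite mulr1.
Qed.

Lemma vweight_ge0 x : 0 <= vweight W x.
Proof. by rewrite vweightE sumr_ge0// => y _; exact: conductance_ge0. Qed.

Lemma laplacian_eq0 h x : average h x = h x -> laplacian W h x = 0.
Proof.
rewrite /laplacian sum_conductance => hx.
under eq_bigr do rewrite mulrBr.
rewrite sumrB -mulr_suml -vweightE mulrBr -/(average h x) hx mulrA.
(* A vertex without neighbours has weight 0; then the convention that 0 has inverse 0 makes the
   average vanish. *)
have [mu0|mu0] := eqVneq (vweight W x) 0; last by rewrite mulVf// mul1r subrr.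
by rewrite -hx /average mu0 invr0 !mul0r subrr.
Qed.

Lemma ler_average f h x : (forall y, f y <= h y) -> average f x <= average h x.
Proof.
move=> fh; rewrite ler_wpM2l ?invr_ge0 ?vweight_ge0// ler_sum// => y _.
by rewrite ler_wpM2l// conductance_ge0.
Qed.

Lemma average_ge0 f x : (forall y, 0 <= f y) -> 0 <= average f x.
Proof.
move=> f0; rewrite mulr_ge0 ?invr_ge0 ?vweight_ge0// sumr_ge0// => y _.
by rewrite mulr_ge0// conductance_ge0.
Qed.

Lemma average_le1 f x : (forall y, f y <= 1) -> average f x <= 1.
Proof.
move=> f1; apply: (le_trans (ler_average x f1)); rewrite /average.
under eq_bigr do rewrite mulr1.
rewrite -vweightE; have [->|mu0] := eqVneq (vweight W x) 0.
  by rewrite mulr0.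
by rewrite mulVf.
Qed.

Lemma average_sum (s : seq G) (F : G -> G -> R) x :
  \sum_(y <- s) average (F y) x = average (fun z => \sum_(y <- s) F y z) x.
Proof.
rewrite /average -mulr_sumr exchange_big; congr (_ * _).
by apply: eq_bigr => z _; rewrite mulr_sumr.
Qed.

Lemma average_ge_neighbour p0 f x y : controlled_weights W p0 ->
  (forall z, 0 <= f z) -> adj W x y -> p0 * f y <= average f x.
Proof.
move=> /(_ x y) cw f0 xy.
apply: (@le_trans _ _ ((vweight W x)^-1 * (conductance W x y * f y))).
  by rewrite mulrA [_^-1 * _]mulrC ler_wpM2r// cw.
rewrite ler_wpM2l ?invr_ge0 ?vweight_ge0//.
have yx : y \in neighbours x.
  by rewrite in_fset_set; [exact/mem_set|exact: adj_locally_finite].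
rewrite (big_rem y)//= lerDl sumr_ge0// => z _.
by rewrite mulr_ge0// conductance_ge0.
Qed.

(* [hit U y k x] is the probability that the walk from [x] leaves [U] within
   [k] steps, at the point [y]. *)
Fixpoint hit (U : pred G) y k x : R :=
  if k is k'.+1 then if U x then average (hit U y k') x else (x == y)%:R
  else (x == y)%:R.

Definition harmonic_measure U y x : R := limn (hit U y ^~ x).

Section Domain.
Variable U : pred G.

Lemma hit_ge0 y k x : 0 <= hit U y k x.
Proof.
by elim: k x => [|k ih] x //=; case: ifP => // _; exact: average_ge0.
Qed.

(** Exits at distinct points are disjoint events; the induction uses linearity of [average]. *)
Lemma sum_hit_le1 (s : seq G) k x : uniq s -> \sum_(y <- s) hit U y k x <= 1.
Proof.
move=> us; have ind z : \sum_(y <- s) (z == y)%:R <= 1 :> R.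
  rewrite -natr_sum -[1]/(1%:R) ler_nat.
  have -> : (\sum_(y <- s) (z == y) = count_mem z s)%N.
    rewrite -sum1_count [RHS]big_mkcond; apply: eq_bigr => y _ /=.
    by rewrite eq_sym; case: eqP.
  by rewrite count_uniq_mem// leq_b1.
elim: k x => [|k ih] x /=; first exact: ind.
by case: (U x); rewrite ?(average_sum s (fun y => hit U y k)); [exact: average_le1|exact: ind].
Qed.

Lemma hit_le1 y k x : hit U y k x <= 1.
Proof. by have := @sum_hit_le1 [:: y] k x isT; rewrite big_seq1. Qed.

Lemma hit_nondecreasing y x : ~~ U y ->
  {homo (hit U y ^~ x) : m n / (m <= n)%N >-> m <= n}.
Proof.
move=> Uy; apply/nondecreasing_seqP => k; elim: k x => [|k ih] x.
  (* Since [y] lies outside [U], the initial value at a point of [U] is 0, so the first step cannot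
     decrease it. *)
  rewrite /=; case: ifP => // Ux; have [xy|_] := eqVneq x y.
    by move: Uy; rewrite -xy Ux.
  by apply: average_ge0 => z /=.
rewrite [leLHS]/= [leRHS]/=; case: ifP => // Ux.
exact: ler_average.
Qed.

Lemma hit_cvg y x : ~~ U y -> hit U y ^~ x @ \oo --> harmonic_measure U y x.
Proof.
move=> Uy; apply: nondecreasing_is_cvgn; first exact: hit_nondecreasing.
by exists 1 => _ [k _ <-]; exact: hit_le1.
Qed.

Lemma harmonic_measure_ge0 y x : ~~ U y -> 0 <= harmonic_measure U y x.
Proof.
by move=> Uy; apply: (cvgr_to_ge (@hit_cvg y x Uy)); near=> k; exact: hit_ge0.
Unshelve. all: by end_near. Qed.

Lemma harmonic_measure_le1 y x : ~~ U y -> harmonic_measure U y x <= 1.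
Proof.
by move=> Uy; apply: (cvgr_to_le (@hit_cvg y x Uy)); near=> k; exact: hit_le1.
Unshelve. all: by end_near. Qed.

Lemma harmonic_measure_self y : ~~ U y -> harmonic_measure U y y = 1.
Proof.
move=> /negbTE Uy; rewrite /harmonic_measure.
rewrite (_ : hit U y ^~ y = cst 1); last first.
  by apply/funext => -[|k] /=; rewrite ?Uy eqxx.
exact: lim_cst.
Qed.

Lemma average_harmonic_measure y x : ~~ U y -> U x ->
  average (harmonic_measure U y) x = harmonic_measure U y x.
Proof.
(* Shifting the index exposes the one-step recursion, whose finite sum passes to the limit. *)
move=> Uy Ux; apply/esym/cvg_lim => //; rewrite -cvg_shiftS /= Ux.
apply: cvgMl_tmp; apply: cvg_big; first exact: add_continuous.
by move=> z _; apply: cvgMl_tmp; exact: hit_cvg.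
Qed.

Lemma sum_harmonic_measure_le1 (s : seq G) x : uniq s -> all (predC U) s ->
  \sum_(y <- s) harmonic_measure U y x <= 1.
Proof.
move=> us /allP sU.
have : \sum_(y <- s) hit U y k x @[k --> \oo] -->
       \sum_(y <- s) harmonic_measure U y x.
  rewrite big_seq; under eq_fun do rewrite big_seq.
  apply: cvg_big; first exact: add_continuous.
  by move=> y /sU; exact: hit_cvg.
by move=> /cvgr_to_le; apply; near=> k; exact: sum_hit_le1.
Unshelve. all: by end_near. Qed.

End Domain.
End HarmonicMeasure.

(** * Lower bounds on harmonic measure from the Harnack inequality *)

Section Harnack.
Local Open Scope classical_set_scope.
Context {R : realType} {G : choiceType} (W : weighted_graph R G).
Variables (C1 p0 : R).
Hypothesis C1_gt0 : 0 < C1.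
Hypothesis ehi : EHI W C1.

(** The bounds on [h] ensure that [sup] and [inf] are true bounds rather than default values. *)
Lemma harnack (h : G -> R) x (r : R) a b : 1 <= r ->
  (forall y, 0 <= h y) -> (forall y, h y <= 1) ->
  harmonic_on W (gball W x (2 * r)) h ->
  gball W x r a -> gball W x r b -> h a <= C1 * h b.
Proof.
move=> r1 h0 h1 hh xa xb; have := ehi r1 h0 hh.
have ha : h a <= sup (h @` gball W x r).
  by apply: ub_le_sup; [exists 1 => _ [y _ <-]|exists a].
have hb : inf (h @` gball W x r) <= h b.
  by apply: ge_inf; [exists 0 => _ [y _ <-]|exists b].
by move=> /(le_trans ha)/le_trans; apply; rewrite ler_wpM2l// ltW.
Qed.

(** Apply the inequality to the constant 1; a vertex is needed to centre a ball. *)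
Lemma EHI_ge1 : G -> 1 <= C1.
Proof.
move=> x; rewrite -[C1]mulr1; apply: (@harnack (cst 1) x 1 x x) => //.
- move=> y _; rewrite /laplacian sum_conductance big1 ?mulr0// => z _.
  by rewrite subrr mulr0.
- by rewrite /gball /= gdistxx.
- by rewrite /gball /= gdistxx.
Qed.

Hypothesis p0_gt0 : 0 < p0.
Hypothesis p0_le1 : p0 <= 1.
Hypothesis cw : controlled_weights W p0.

Section Sphere.
Variables (x0 : G) (n : nat) (y : G).
Hypothesis x0y : gdist W x0 y = n.

Let U : pred G := fun z => (gdist W x0 z < n)%N.
Let h := harmonic_measure W U y.

Let Uy : ~~ U y. Proof. by rewrite /U x0y ltnn. Qed.

Let h_ge0 z : 0 <= h z. Proof. exact: harmonic_measure_ge0. Qed.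

(** Follow the walk to [y]: each step costs a factor [p0], and the distance condition keeps the walk
    in [U] until it reaches [y]. *)
Lemma harmonic_measure_near k z : walk W z y k ->
  (gdist W x0 z + k <= n)%N -> p0 ^+ k <= h z.
Proof.
elim: k z => [|k ih] z; first by move=> /walk0 -> _; rewrite /h harmonic_measure_self.
rewrite -add1n => /walk_split[w zw wy] zn.
have Uz : U z by rewrite /U; lia.
have w0 := gdist_triangle W z x0 w; have w1 := gdist_le_walk zw.
rewrite /h -average_harmonic_measure// exprS.
apply: le_trans (average_ge_neighbour cw h_ge0 (walk1 zw)).
by apply: ler_wpM2l; [exact: ltW|apply: ih => //; lia].
Qed.

(** The hypotheses put [z] on a geodesic from [x0] to [y], at distance [i.+1] from [y]. Thus the
    ball of radius [i] about [z] stays inside [U], and Harnack compares [z] with a point halfway to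
    [y]. *)
Lemma harmonic_measure_chain m i z : (i <= 2 ^ m)%N -> walk W z y i.+1 ->
  (gdist W x0 z + i.+1 <= n)%N -> p0 ^+ 2 / C1 ^+ m <= h z.
Proof.
have C1_ge1 := EHI_ge1 x0.
elim: m i z => [|m ih] i z im zy zn.
  (* Here [i] is at most 1, so at most two steps remain: this is the source of [p0 ^+ 2]. *)
  rewrite expr0 divr1; apply: le_trans (harmonic_measure_near zy zn).
  by apply: ler_wiXn2l => //; exact: ltW.
have [im'|mi] := leqP i (2 ^ m).
  apply: le_trans (ih _ _ im' zy zn); apply: ler_wpM2l.
    by rewrite exprn_ge0// ltW.
  by rewrite lef_pV2 ?posrE ?exprn_gt0// ler_weXn2l.
(* This makes the Harnack radius [i / 2] at least 1. *)
have i2 : (1 < i)%N by apply: leq_trans mi; rewrite ltnS expn_gt0.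
have i2E : (uphalf i + i./2 = i)%N.
  by rewrite uphalf_half -addnA addnn odd_double_half.
have [w zw wy] : exists2 w, walk W z w i./2 & walk W w y (uphalf i).+1.
  by apply: walk_split; rewrite addnS [(i./2 + _)%N]addnC i2E.
have w0 := gdist_triangle W z x0 w; have w1 := gdist_le_walk zw.
have hw : p0 ^+ 2 / C1 ^+ m <= h w.
  apply: (ih (uphalf i)) => //; last by lia.
  by move: im; rewrite expnS; lia.
have hwz : h w <= C1 * h z.
  apply: (@harnack h z (i%:R / 2)) => //.
  - by rewrite ler_pdivlMr// mul1r ler_nat.
  - by move=> v; exact: harmonic_measure_le1.
  - move=> v; rewrite /gball /= mulrC divfK// ler_nat => zv.
    apply/laplacian_eq0/average_harmonic_measure => //.
    by have := gdist_triangle W z x0 v; rewrite /U; lia.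
  - rewrite /gball /= ler_pdivlMr// -natrM ler_nat; lia.
  - by rewrite /gball /= gdistxx divr_ge0.
rewrite [C1 ^+ _]exprS invfM mulrCA ler_pdivrMl//.
exact: le_trans hw hwz.
Qed.

Lemma harmonic_measure_center m : (n <= 2 ^ m)%N ->
  p0 ^+ 2 / C1 ^+ m <= h x0.
Proof.
(* The chain needs a walk of positive length, so the case of [y] equal to [x0] is separate. *)
move=> nm; have [n0|n0] := posnP n.
  have -> : h x0 = 1.
    have <- : y = x0 by apply/esym/walk0; rewrite -n0 -x0y; exact: gdist_walk.
    exact: harmonic_measure_self.
  rewrite ler_pdivrMr ?exprn_gt0// mul1r (@le_trans _ _ 1)//.
    by rewrite exprn_ile1// ltW.
  by rewrite exprn_ege1// EHI_ge1.
apply: (@harmonic_measure_chain m n.-1); first by lia.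
  by rewrite prednK// -x0y; exact: gdist_walk.
by rewrite gdistxx prednK.
Qed.

End Sphere.

(** * Counting points in spheres and balls *)

Lemma size_sphere_le x0 n m (s : seq G) : (n <= 2 ^ m)%N -> uniq s ->
  (forall y, y \in s -> gdist W x0 y = n) -> (size s)%:R <= C1 ^+ m / p0 ^+ 2.
Proof.
move=> nm us sn; set U : pred G := fun z => (gdist W x0 z < n)%N.
have : \sum_(y <- s) (p0 ^+ 2 / C1 ^+ m) <= 1.
  apply: le_trans (@sum_harmonic_measure_le1 _ _ W U s x0 us _).
    by rewrite !big_seq ler_sum// => y /sn yn; exact: (harmonic_measure_center yn nm).
  by apply/allP => y /sn /= yn; rewrite /U yn ltnn.
rewrite big_const_seq count_predT iter_addr_0 -[_ *+ _]mulr_natl.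
by rewrite -ler_pdivlMr ?divr_gt0 ?exprn_gt0// mul1r invf_div.
Qed.

(** Split by distance into [N.+1] spheres; the same [m] serves them all. *)
Lemma size_ball_le x0 N m (s : seq G) : (N <= 2 ^ m)%N -> uniq s ->
  (forall y, y \in s -> gdist W x0 y <= N)%N ->
  (size s)%:R <= N.+1%:R * (C1 ^+ m / p0 ^+ 2).
Proof.
move=> Nm us sN.
pose d (y : G) : 'I_N.+1 := inord (gdist W x0 y).
rewrite -sum1_size (partition_big d predT)//= natr_sum.
rewrite -[X in _ <= X%:R * _]card_ord mulr_natl -sumr_const ler_sum// => j _.
rewrite sum1_count -size_filter; apply: (@size_sphere_le x0 j).
- by apply: leq_trans Nm; rewrite -ltnS.
- exact: filter_uniq.
- move=> y; rewrite mem_filter => /andP[/eqP <- /sN yN].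
  by rewrite /d inordK.
Qed.

End Harnack.

(* theta depends only on C1.  The multiplicative constant C is uniform over all
   weighted graphs with the same C1 and the same controlled-weights constant
   p0; it cannot be uniform in p0 (replace every vertex of the line by an
   N-clique, joining consecutive cliques completely). *)
Theorem theorem1 (R : realType) (C1 : R) (hC1 : 0 < C1) :
  exists theta : R,
    forall p0 : R, 0 < p0 ->
      exists C : R,
        forall (G : choiceType) (W : weighted_graph R G),
          controlled_weights W p0 -> EHI W C1 ->
          forall (x0 : G) (r : R), 1 <= r ->
            (counting (gball W x0 r) <= (C * r `^ (1 + theta))%:E)%E.
Proof.
pose theta : R := ln C1 / ln 2; exists theta => p0 p0_gt0.
(* On a graph without edges [p0] may exceed 1, whereas the estimates above use a constant at most
   1. *)
pose q := Num.min p0 1.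
have q_gt0 : 0 < q by rewrite lt_min p0_gt0 ltr01.
have q_le1 : q <= 1 by rewrite ge_min lexx orbT.
(* The leading 2 absorbs the number of spheres, at most [2 * r]; the factor with exponent [theta]
   pays for rounding the radius up to a power of two. *)
exists (2 * (2 `^ theta / q ^+ 2)) => G W cw ehi x0 r r1.
have cwq : controlled_weights W q.
  by move=> x y /cw; apply: le_trans; rewrite ge_min lexx.
have C1_ge1 : 1 <= C1 by exact: EHI_ge1 ehi x0.
have r0 : 0 <= r by exact: le_trans r1.
have theta0 : 0 <= theta by rewrite divr_ge0// ln_ge0// ler1n.
have finB := finite_gball W x0 r.
rewrite /counting asboolT// lee_fin.
set N := Num.truncn r; have Nr : N%:R <= r by rewrite -truncn_ge_nat.
have N1 : (0 < N)%N by rewrite truncn_gt0.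
(* The least exponent with [N < 2 ^ m], so that also [2 ^ m <= 2 * N]. *)
set m := (trunc_log 2 N).+1.
have Nm : (N <= 2 ^ m)%N by rewrite ltnW// trunc_log_ltn.
have mN : (2 ^ m <= 2 * N)%N by rewrite expnS leq_mul2l trunc_logP.
(* As [C1] is 2 to the power [theta], the left side is [2 ^ m] to the power [theta], and [2 ^ m] is
   at most [2 * r]. *)
have C1m : C1 ^+ m <= 2 `^ theta * r `^ theta.
  have -> : C1 = 2 `^ theta.
    by rewrite /powR pnatr_eq0 /= divfK ?lnK ?posrE// gt_eqF// ln_gt0// ltr1n.
  rewrite -powR_mulrn ?powR_ge0// -powRrM mulrC powRrM powR_mulrn// -powRM//.
  apply: ge0_ler_powR => //; rewrite ?nnegrE ?exprn_ge0 ?mulr_ge0//.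
  by rewrite -natrX (@le_trans _ _ (2 * N)%:R) ?ler_nat// natrM ler_wpM2l.
have /le_trans-> // :
    #|` fset_set (gball W x0 r)|%:R <= N.+1%:R * (C1 ^+ m / q ^+ 2).
  apply: (@size_ball_le _ _ _ _ _ hC1 ehi q_gt0 q_le1 cwq x0) => //.
  by move=> y; rewrite in_fset_set// => /set_mem; rewrite /gball /= truncn_ge_nat.
rewrite powRD; last by rewrite [r == 0]gt_eqF ?implybT// (lt_le_trans ltr01).
rewrite powRr1//.
rewrite [leRHS](_ : _ = (2 * r) * ((2 `^ theta * r `^ theta) / q ^+ 2));
  last by ring.
apply: ler_pM => //.
- by rewrite divr_ge0 ?exprn_ge0 ?ltW.
- by rewrite -natr1; lra.
- by rewrite ler_wpM2r// invr_ge0 exprn_ge0 ?ltW.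
Qed.
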